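(* Assume the stick principle. Then there is an uncountable almost disjoint family (on a countable set) which is strongly near-Luzin but has no uncountable Luzin subfamily.
   Context: Stick principle: there is a family $\mathcal S$ of countable subsets of $\omega_1$ with $|\mathcal S|=\omega_1$ such that every uncountable subset of $\omega_1$ contains some member of $\mathcal S$. An almost disjoint family is a collection of infinite sets whose pairwise intersections are finite. An uncountable almost disjoint family $\mathcal A$ is strongly near-Luzin iff for every $n<\omega$ and all uncountable $\mathcal C_0,\dots,\mathcal C_n\subseteq\mathcal A$, the set $\bigcap_{i\le n}\bigcup\mathcal C_i$ is infinite. For an uncountable almost disjoint family $\mathcal A$ on a countable set $W$: $\mathcal A$ is Luzin iff there is an enumeration $\mathcal A=\{a_\alpha:\alpha<\omega_1\}$ such that for every finite $w\subseteq W$ and every $\alpha<\omega_1$ the set $\{\beta<\alpha: a_\alpha\cap a_\beta\subseteq w\}$ is finite. *)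

(* Defs.v *)
From mathcomp Require Import all_boot all_order.
From mathcomp Require Import boolp classical_sets functions cardinality.
Set Implicit Arguments. Unset Strict Implicit. Unset Printing Implicit Defensive.
Local Open Scope classical_set_scope.
Local Open Scope card_scope.

(* A model of omega_1: a strict well-order (O, lt) which is uncountable and
   all of whose proper initial segments are countable.  Such an order is
   unique up to isomorphism (it is omega_1). *)
Definition is_omega1 (O : Type) (lt : O -> O -> Prop) : Prop :=
  (forall a, ~ lt a a) /\
  (forall a b c, lt a b -> lt b c -> lt a c) /\
  (forall a b, lt a b \/ a = b \/ lt b a) /\
  well_founded lt /\
  ~ countable [set: O] /\
  (forall a, countable [set b | lt b a]).

Definition stick_principle (O : Type) : Prop :=
  exists S : set (set O),
    [/\ S #= [set: O],
        (forall s, S s -> countable s /\ infinite_set s)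
      & (forall X : set O, ~ countable X -> exists2 s, S s & s `<=` X)].

Definition almost_disjoint (W : Type) (A : set (set W)) : Prop :=
  (forall a, A a -> infinite_set a) /\
  (forall a b, A a -> A b -> a <> b -> finite_set (a `&` b)).

Definition strongly_near_Luzin (W : Type) (A : set (set W)) : Prop :=
  almost_disjoint A /\ ~ countable A /\
  forall (n : nat) (C : 'I_n.+1 -> set (set W)),
    (forall i, C i `<=` A /\ ~ countable (C i)) ->
    infinite_set [set x | forall i, exists2 c, C i c & c x].

Definition Luzin (O : Type) (lt : O -> O -> Prop) (W : Type) (A : set (set W))
  : Prop :=
  almost_disjoint A /\ ~ countable A /\
  exists e : O -> set W,
    [/\ injective e, e @` [set: O] = A &
        forall (w : set W) (alpha : O), finite_set w ->
          finite_set [set beta | lt beta alpha /\ e alpha `&` e beta `<=` w]].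

(* Main.v *)
Require Import Defs.
From Stdlib Require List.
From mathcomp Require Import all_boot all_order.
From mathcomp Require Import boolp classical_sets functions cardinality.
Local Open Scope classical_set_scope.
Local Open Scope card_scope.

(** Attach to every member a_alpha of the family its own real r_alpha in
    2^omega, and let every point x of the countable underlying set carry a
    clopen set K_x, with x in a_alpha only if r_alpha is in K_x.  The pairs
    (r_alpha, a_alpha) are built by recursion on alpha, by finite approximation.

    Against Luzin: if s is an earlier infinite set of the stick family, the reals
    r_beta (beta in s) accumulate at some p.  Only a finite part w of a_alpha lies
    in clopen sets containing p, and any finite part of a_alpha outside w lies in
    clopen sets missing the r_beta close to p; so one can keep
    a_alpha /\ a_beta inside w for infinitely many beta in s.  By the stick
    principle every uncountable subfamily contains such an s.

    For near-Luzin: a set X of points is positive with respect to a finite set Q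
    of reals if it has points x whose K_x meets prescribed open sets V_i, stays
    inside their union and a prescribed neighbourhood of Q, yet misses Q itself.
    Shrinking the V_i and the neighbourhood makes K_x avoid any further finite
    set of reals, hence a_alpha can be made to hit X, even positively, while
    staying almost disjoint from its predecessors.  Consequently, if X is
    positive and s is a later stick set, X intersected with the union of the
    a_beta (beta in s) is positive with respect to Q and a limit of the r_beta;
    one such step for each of the given uncountable subfamilies gives the
    infinite intersection. *)

(** * Countability and recursion *)

Lemma countableU {T : Type} (A B : set T) :
  countable A -> countable B -> countable (A `|` B).
Proof.
move=> cA cB; rewrite -bigcup2E; apply: bigcup_countable => // -[|[|i]] _ //=.
Qed.

Lemma countable_image {T U : Type} (f : T -> U) (A : set T) :
  countable A -> countable (f @` A).
Proof. by apply: sub_countable; exact: card_image_le. Qed.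

Lemma countable_subset {T : Type} (A B : set T) :
  A `<=` B -> countable B -> countable A.
Proof. by move=> /subset_card_le; exact: sub_countable. Qed.

Lemma countable_preimage {T U : Type} (f : T -> U) (B : set U) :
  injective f -> countable B -> countable (f @^-1` B).
Proof.
move=> finj /countable_injP[g ginj]; apply/countable_injP; exists (g \o f).
move=> x y; rewrite !inE /= => Bx By.
by move=> /ginj h; apply: finj; apply: h; rewrite inE.
Qed.

Lemma countable_lists {T : Type} (A : set T) :
  countable A -> countable [set t : seq T | forall x, List.In x t -> A x].
Proof.
move=> /countable_injP[g ginj]; apply/countable_injP.
exists (choice.pickle \o map g) => t u; rewrite !inE /= => tA uA.
move=> /(pcan_inj choice.pickleK).
elim: t u tA uA => [|x t IH] [|y u] //= tA uA [gxy tu].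
rewrite (ginj x y) ?inE; [|by apply: tA; left|by apply: uA; left|by []].
by rewrite (IH u)// => z zt; [apply: tA; right|apply: uA; right].
Qed.

(** An injection into nat numbers the dense sets; step n moves into the set numbered n, if there is
    one. *)
Lemma generic_sequence {C : Type} (V : set C) (le : C -> C -> Prop)
    (D : set (set C)) (c0 : C) :
  V c0 -> (forall c, le c c) -> countable D ->
  (forall d, D d -> forall c, V c -> exists c', [/\ V c', le c c' & d c']) ->
  exists c : nat -> C,
    [/\ forall n, V (c n), forall n, le (c n) (c n.+1)
      & forall d, D d -> exists n, d (c n)].
Proof.
move=> V0 lerefl /countable_injP[g ginj] dense.
have step (nc : nat * C) : exists c', V nc.2 ->
    [/\ V c', le nc.2 c' & forall d, D d -> g d = nc.1 -> d c'].
  case: nc => n c; have [Vc|nVc] := pselect (V c); last by exists c.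
  have [[d [Dd gd]]|nd] := pselect (exists d, D d /\ g d = n).
    have [c' [Vc' lec' dc']] := dense d Dd c Vc.
    exists c' => _; split=> // d' Dd' gd'.
    by rewrite (ginj d' d)// ?inE// gd' gd.
  by exists c => _; split=> // d Dd gd; case: nd; exists d.
have [f fP] := choice step.
pose c := fix c n := if n is m.+1 then f (m, c m) else c0.
have Vc n : V (c n).
  by elim: n => //= n /(fP (n, c n))[].
exists c; split=> // [n|d Dd]; first by have [] := fP (n, c n) (Vc n).
by exists (g d).+1 => /=; have [_ _] := fP (g d, c (g d)) (Vc _); apply.
Qed.

Lemma wf_recursive_choice {O S : Type} (lt : O -> O -> Prop)
    (Phi : O -> (O -> S) -> S -> Prop) :
  well_founded lt ->
  (forall a f g, (forall b, lt b a -> f b = g b) ->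
     forall y, Phi a f y -> Phi a g y) ->
  (forall a f, exists y, Phi a f y) ->
  inhabited S ->
  exists F : O -> S, forall a, Phi a F (F a).
Proof.
move=> wf local ex [y0].
have [h hP] := choice (fun af : O * (O -> S) => ex af.1 af.2).
(* Values not yet defined are filled with the dummy [y0]; [local] makes [Phi] blind to them. *)
pose extend a (rec : forall b, lt b a -> S) b :=
  if pselect (lt b a) is left ba then rec b ba else y0.
pose step a rec := h (a, extend a rec).
exists (Fix wf (fun=> S) step) => a.
rewrite Fix_eq => [|{}a f g fg]; last first.
  by rewrite /step; congr h; congr pair; apply: funext => b; rewrite /extend;
    case: pselect.
apply: (local _ _ _ _ _ (hP (a, _))) => b ba /=.
by rewrite /extend; case: pselect.
Qed.

(** * Reals and clopen sets *)

Definition point := nat -> bool.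

Definition agree (n : nat) (p q : point) : Prop := forall i, i < n -> p i = q i.

Definition cyl (s : seq bool) (p : point) : Prop :=
  agree (size s) (nth false s) p.

(* The second component lists cylinders whose union is the clopen set K_x of the
   point x; the first one only provides infinitely many copies of it. *)
Definition atom := (nat * seq (seq bool))%type.

Definition clopen (x : atom) (p : point) : Prop := exists2 s, s \in x.2 & cyl s p.

Definition near (n : nat) (Q : seq point) (p : point) : Prop :=
  exists2 q, q \in Q & agree n q p.

Lemma agree_le {m n p q} : m <= n -> agree n p q -> agree m p q.
Proof. by move=> mn pq i im; apply: pq; exact: leq_trans mn. Qed.

Lemma agree_sym {n p q} : agree n p q -> agree n q p.
Proof. by move=> pq i /pq. Qed.

Lemma agree_trans {n p q r} : agree n p q -> agree n q r -> agree n p r.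
Proof. by move=> pq qr i ni; rewrite pq// qr. Qed.

Lemma near_le {m n Q p} : m <= n -> near n Q p -> near m Q p.
Proof. by move=> mn [q Qq /(agree_le mn)]; exists q. Qed.

Lemma separate p (D : seq point) :
  exists n, forall d, d \in D -> agree n p d -> d = p.
Proof.
elim: D => [|e D [n nP]]; first by exists 0.
have [->|ep] := pselect (e = p).
  by exists n => d; rewrite inE => /orP[/eqP //|]; exact: nP.
have /existsNP[i /eqP pei] : ~ (forall i, p i = e i).
  by move=> /funext pe; apply: ep.
exists (maxn n i.+1) => d; rewrite inE => /orP[/eqP -> pe|Dd pd].
  by move: pei; rewrite pe ?eqxx// leq_maxr.
by apply: nP => //; apply: agree_le pd; exact: leq_maxl.
Qed.

Lemma separate_seqs (Q D : seq point) :
  exists n, forall q d, q \in Q -> d \in D -> agree n q d -> d = q.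
Proof.
elim: Q => [|p Q [n nP]]; first by exists 0.
have [m mP] := separate p D; exists (maxn m n) => q d; rewrite inE.
move=> /orP[/eqP -> | Qq] Dd qd.
  by apply: mP => //; apply: agree_le qd; exact: leq_maxl.
by apply: nP => //; apply: agree_le qd; exact: leq_maxr.
Qed.

Lemma clopen_agree (x : atom) :
  exists n, forall p q, agree n p q -> clopen x p -> clopen x q.
Proof.
case: x => k; elim=> [|s l [n nP]]; first by exists 0 => p q _ [].
exists (maxn (size s) n) => p q pq [t]; rewrite inE => /orP[/eqP -> sp|lt tp].
  exists s; rewrite ?mem_head//; apply: agree_trans sp _.
  by apply: agree_le pq; exact: leq_maxl.
have [||u lu uq] := nP p q; first by apply: agree_le pq; exact: leq_maxr.
- by exists t.
- by exists u => //; rewrite inE lu orbT.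
Qed.

Lemma clopens_agree (F : seq atom) :
  exists n, forall x p q, x \in F -> agree n p q -> clopen x p -> clopen x q.
Proof.
elim: F => [|y F [n nP]]; first by exists 0.
have [m mP] := clopen_agree y; exists (maxn m n) => x p q; rewrite inE.
move=> /orP[/eqP -> pq|Fx pq].
  by apply: mP; apply: agree_le pq; exact: leq_maxl.
by apply: nP => //; apply: agree_le pq; exact: leq_maxr.
Qed.

Lemma cyl_prefix {s t p} : prefix s t -> cyl t p -> cyl s p.
Proof.
move=> /prefixP[u ->] tp i si.
by rewrite -tp ?nth_cat ?si// size_cat ltn_addr.
Qed.

Lemma cyl_mkseq p n q : cyl (mkseq p n) q <-> agree n p q.
Proof.
rewrite /cyl size_mkseq; split=> h i ni; first by rewrite -h// nth_mkseq.
by rewrite nth_mkseq// h.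
Qed.

Lemma cyl_nth s : cyl s (nth false s).
Proof. by []. Qed.

Lemma cyl_extend_to s p n : cyl s p ->
  exists t, [/\ prefix s t, n <= size t & forall q, cyl t q -> agree n p q].
Proof.
move=> sp; exists (mkseq p (maxn (size s) n)); split.
- have {1}-> : s = mkseq p (size s).
    apply: (@eq_from_nth _ false); first by rewrite size_mkseq.
    by move=> i si; rewrite nth_mkseq// sp.
  rewrite prefixE size_mkseq /mkseq -map_take take_iota.
  by have /minn_idPl -> := leq_maxl (size s) n.
- by rewrite size_mkseq leq_maxr.
- by move=> q /cyl_mkseq; apply: agree_le; exact: leq_maxr.
Qed.

Lemma cyl_avoid s (D : seq point) :
  exists2 t, prefix s t & forall d, d \in D -> ~ cyl t d.
Proof.
elim: D => [|d D [t st tP]]; first by exists s; rewrite ?prefix_refl.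
exists (rcons t (~~ d (size t))).
  by apply: prefix_trans st _; exact: prefix_rcons.
move=> e; rewrite inE => /orP[/eqP -> /(_ (size t))|De].
  rewrite size_rcons ltnS leqnn nth_rcons ltnn eqxx => /(_ isT).
  by case: (d _).
by move/(cyl_prefix (prefix_rcons _ _)); exact: tP.
Qed.

Lemma cyls_avoid (Vs : seq (seq bool)) (D : seq point) :
  exists Us : seq (seq bool), [/\ size Us = size Vs,
    forall i, i < size Vs -> prefix (nth [::] Vs i) (nth [::] Us i) &
    forall U d, U \in Us -> d \in D -> ~ cyl U d].
Proof.
elim: Vs => [|V Vs [Us [sUs VU UD]]]; first by exists [::].
have [U pU UP] := cyl_avoid V D; exists (U :: Us); split=> /=.
- by rewrite sUs.
- by case=> //= i /VU.
- by move=> t d; rewrite inE => /orP[/eqP -> /UP|/UD]; last exact.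
Qed.

(** Bisection: if a cylinder holds infinitely many members of [R], so does one of its halves; [p] is
    the branch obtained by always choosing such a half. *)
Lemma acc_point (R : set point) : infinite_set R ->
  exists p, forall n, exists2 q, R q & q <> p /\ agree n p q.
Proof.
move=> Rinf.
pose big s := infinite_set [set q | R q /\ cyl s q].
have step s : exists b, big s -> big (rcons s b).
  have [bs|nbs] := pselect (big s); last by exists true.
  have [bt|nbt] := pselect (big (rcons s true)); first by exists true.
  exists false => _ bf; apply: bs.
  have : finite_set ([set q | R q /\ cyl (rcons s true) q] `|`
                     [set q | R q /\ cyl (rcons s false) q]).
    by rewrite finite_setU; split=> //; exact: contrapT.
  apply: sub_finite_set => q [Rq sq].
  suff : cyl (rcons s (q (size s))) q by case: (q _); [left|right].
  move=> i; rewrite size_rcons ltnS nth_rcons leq_eqVlt => /orP[/eqP ->|si].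
    by rewrite ltnn eqxx.
  by rewrite si sq.
have [f fP] := choice step.
pose s := fix s n := if n is m.+1 then rcons (s m) (f (s m)) else [::].
have bigs n : big (s n).
  elim: n => [|n /fP //]; apply: contra_not Rinf; apply: sub_finite_set.
  by move=> q Rq; split.
have sizes n : size (s n) = n by elim: n => //= n; rewrite size_rcons => ->.
exists (fun i => f (s i)) => n.
have sE m i : i < m -> nth false (s m) i = f (s i).
  elim: m => //= m IH; rewrite nth_rcons sizes ltnS leq_eqVlt.
  by move=> /orP[/eqP ->|/[dup] /IH + ->//]; rewrite ltnn eqxx.
apply: contrapT => nq; apply: (bigs n).
apply: sub_finite_set (finite_set1 (fun i => f (s i) : bool)) => q [Rq sq] /=.
apply: contrapT => qp; apply: nq; exists q => //; split=> // i ni.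
by rewrite -(sE n)// sq// sizes.
Qed.

Lemma acc_infinite (R : set point) p :
  (forall n, exists2 q, R q & q <> p /\ agree n p q) -> infinite_set R.
Proof.
move=> Racc /finite_seqP[l lE].
have [n nP] := separate p l; have [q + [qp pq]] := Racc n.
by rewrite lE /= => /nP /(_ pq).
Qed.

(** * Positive sets and the generic step *)

Definition fits (n : nat) (Q : seq point) (Vs : seq (seq bool)) (x : atom) :=
  [/\ forall V, V \in Vs -> exists2 p, clopen x p & cyl V p,
      forall p, clopen x p -> near n Q p \/ exists2 V, V \in Vs & cyl V p
    & forall q, q \in Q -> ~ clopen x q].

Definition positive (Q : seq point) (X : set atom) : Prop :=
  forall n Vs (w : seq atom), Vs <> [::] ->
    exists x, [/\ X x, x \notin w & fits n Q Vs x].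

(* What the generic step achieves for a /\ X: every witness contains r, and K_x
   may in addition use any prescribed neighbourhood [mkseq r n] of r. *)
Definition positive_at (r : point) (Q : seq point) (X : set atom) : Prop :=
  forall n Vs (w : seq atom),
    exists x, [/\ X x, x \notin w, clopen x r & fits n Q (mkseq r n :: Vs) x].

Lemma positive_setT : positive [::] setT.
Proof.
move=> n Vs w Vs0; pose k := \max_(x <- w) x.1.
exists (k.+1, Vs); split=> //.
  apply/negP => kw.
  by have := @leq_bigmax_seq _ w xpredT fst (k.+1, Vs) kw isT; rewrite -/k ltnn.
split=> // [V VVs|p [V VVs Vp]]; last by right; exists V.
by exists (nth false V) => //; exists V.
Qed.

(** Shrink the cylinders off [D], and the neighbourhood of [Q] until it contains no real of [D]
    outside [Q]; the reals of [Q] are missed anyway. *)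
Lemma positive_avoid {Q X} (D : seq point) n Vs (w : seq atom) :
  positive Q X -> Vs <> [::] ->
  exists x, [/\ X x, x \notin w, fits n Q Vs x
              & forall d, d \in D -> ~ clopen x d].
Proof.
move=> posX Vs0.
have [Us [sUs VU UD]] := cyls_avoid Vs D.
have [m mP] := separate_seqs Q D.
have Us0 : Us <> [::] by case: Us sUs {VU UD} => //; case: Vs Vs0.
have [x [Xx xw [meetU sub avoidQ]]] := posX (maxn n m) Us w Us0.
exists x; split=> //; first split=> //.
- move=> V VVs; have iV : index V Vs < size Vs by rewrite index_mem.
  have [|p xp Up] := meetU (nth [::] Us (index V Vs)).
    by rewrite mem_nth// sUs.
  by exists p => //; apply: cyl_prefix Up; rewrite -{1}(nth_index [::] VVs) VU.
- move=> p /sub[nearp|[U UUs Up]].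
    by left; apply: near_le nearp; exact: leq_maxl.
  right; have iU : index U Us < size Vs by rewrite -sUs index_mem.
  exists (nth [::] Vs (index U Us)); first exact: mem_nth.
  by apply: cyl_prefix Up; rewrite -{2}(nth_index [::] UUs) VU.
move=> d Dd xd; case: (sub d xd) => [[q Qq qd]|[U UUs Ud]].
  move: xd; rewrite (mP q d)//; first exact: avoidQ.
  by apply: agree_le qd; exact: leq_maxr.
exact: UD Ud.
Qed.

(* A finite approximation to the pair (r, a) built by [generic_stage]: a finite
   part of a, an initial segment of r, and finitely many reals that no further
   element of a may contain. *)
Record approx := Approx {
  part : seq atom; stem : seq bool; forbidden : seq point }.

(** The invariant that every real through the stem is still eligible as r. *)
Definition valid (c : approx) : Prop :=
  (forall d, d \in forbidden c -> ~ cyl (stem c) d) /\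
  (forall x p, x \in part c -> cyl (stem c) p -> clopen x p).

Definition extends (c c' : approx) : Prop :=
  [/\ {subset part c <= part c'}, prefix (stem c) (stem c'),
      {subset forbidden c <= forbidden c'}
    & forall x, x \in part c' -> x \notin part c ->
      forall d, d \in forbidden c -> ~ clopen x d].

Lemma extends_refl c : extends c c.
Proof. by split=> // [|x -> //]; exact: prefix_refl. Qed.

Lemma extends_trans c d e : extends c d -> extends d e -> extends c e.
Proof.
move=> [cd1 cd2 cd3 cd4] [de1 de2 de3 de4]; split.
- by move=> x /cd1 /de1.
- exact: prefix_trans cd2 de2.
- by move=> x /cd3 /de3.
- move=> x ex cx p cp; have [dx|dx] := boolP (x \in part d); first exact: cd4.
  by apply: de4 => //; exact: cd3.
Qed.

Lemma forbid (p : point) c : valid c ->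
  exists c', [/\ valid c', extends c c', part c' = part c
               & p \in forbidden c'].
Proof.
move=> [fc pc]; have [t ct tp] := cyl_avoid (stem c) [:: p].
exists (Approx (part c) t (p :: forbidden c)); split=> //=.
- split=> /= [d|x q cx tq]; last by apply: pc => //; exact: cyl_prefix tq.
  rewrite inE => /orP[/eqP ->|/fc fd /(cyl_prefix ct)//].
  by apply: tp; rewrite mem_head.
- split=> //= [d|x ->//]; first by rewrite inE orbC => ->.
- exact: mem_head.
Qed.

Lemma dense_stem n c : valid c ->
  exists c', [/\ valid c', extends c c' & n <= size (stem c')].
Proof.
move=> [fc pc]; have [t [ct nt _]] := cyl_extend_to _ _ n (cyl_nth (stem c)).
exists (Approx (part c) t (forbidden c)); split=> //.
  split=> /= [d /fc fd /(cyl_prefix ct)//|x q cx tq].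
  by apply: pc => //; exact: cyl_prefix tq.
by split=> //= x ->.
Qed.

(** If no K_x with x in the part outside [w] contains [p], then neither does any contain a real [q]
    of [R] close enough to [p], as these sets are finitely many and clopen. Forbidding [q] extends
    this to all later elements. *)
Lemma dense_disjoint (R : set point) p (w : seq atom) n c :
  (forall n, exists2 q, R q & q <> p /\ agree n p q) -> valid c ->
  exists c', [/\ valid c', extends c c' &
    (exists x, [/\ x \in part c', x \notin w & clopen x p]) \/
    (exists q, [/\ R q, q <> p, agree n p q, q \in forbidden c' &
      forall x, x \in part c' -> clopen x q -> x \in w])].
Proof.
move=> Racc vc.
have [px|npx] := pselect (exists x, [/\ x \in part c, x \notin w & clopen x p]).
  by exists c; split=> //; [exact: extends_refl|left].
have [m mP] := clopens_agree (part c).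
have [q Rq [qp pq]] := Racc (maxn n m).
have [c' [vc' cc' cE c'q]] := forbid q c vc.
exists c'; split=> //; right; exists q; split=> //.
  by apply: agree_le pq; exact: leq_maxl.
move=> x; rewrite cE => cx xq; apply: contrapT => /negP xw; apply: npx.
exists x; split=> //; apply: mP xq => //.
by apply: agree_sym; apply: agree_le pq; exact: leq_maxr.
Qed.

(** Prescribing the cylinder of a longer stem [t] makes K_x meet it, so the stem can then be
    lengthened into K_x, which allows x to join the part. *)
Lemma dense_hit Q X n Vs (w : seq atom) c : positive Q X -> valid c ->
  exists c', [/\ valid c', extends c c' & exists x t,
    [/\ x \in part c', X x /\ x \notin w, prefix t (stem c'), n <= size t
      & fits n Q (t :: Vs) x]].
Proof.
move=> posX [fc pc].
have [t [ct nt _]] := cyl_extend_to _ _ n (cyl_nth (stem c)).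
have [//|x [Xx xw fx xd]] :=
  positive_avoid (forbidden c) n (t :: Vs) (w ++ part c) posX.
have [m mP] := clopen_agree x.
have [p xp tp] : exists2 p, clopen x p & cyl t p.
  by case: fx => + _ _; apply; exact: mem_head.
have [u [tu _ up]] := cyl_extend_to _ _ m tp.
exists (Approx (x :: part c) u (forbidden c)); split.
- split=> /= [d /fc fd /(cyl_prefix tu)/(cyl_prefix ct)//|y q].
  rewrite inE => /orP[/eqP -> /up pq|cy uq]; first exact: mP xp.
  by apply: pc => //; apply: cyl_prefix ct _; exact: cyl_prefix uq.
- split=> //= [y cy||y].
  + by rewrite inE cy orbT.
  + exact: prefix_trans tu.
  + by rewrite inE => /orP[/eqP ->|->].
- exists x, t; split=> //=; first exact: mem_head.
  by split=> //; move: xw; rewrite mem_cat negb_or => /andP[].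
Qed.

(* Rasiowa-Sikorski for countably many dense sets of approximations. *)
Lemma generic_stage (P : set point) (RR : set (set point))
    (XX : set (set atom)) (Qf : set atom -> seq point) :
  countable P -> countable RR -> countable XX ->
  exists (r : point) (a : set atom),
    [/\ ~ P r,
        forall x, a x -> clopen x r,
        forall p, P p -> finite_set [set x | a x /\ clopen x p],
        forall R, RR R -> infinite_set R -> exists w : seq atom,
          infinite_set [set q | R q /\ forall x, a x -> clopen x q -> x \in w]
      & forall X, XX X -> positive (Qf X) X ->
          positive_at r (Qf X) (a `&` X)].
Proof.
move=> cP cRR cXX.
(* For finite [R] the accumulation point is a dummy. *)
have accE (R : set point) : exists p, infinite_set R ->
    forall n, exists2 q, R q & q <> p /\ agree n p q.
  have [/acc_point[p pP]|nR] := pselect (infinite_set R); first by exists p.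
  by exists (fun=> false).
have [acc accP] := choice accE.
pose Dstem n := [set c | n <= size (stem c)].
pose Dforb p := [set c | p \in forbidden c].
pose Ddis (y : set point * (seq atom * nat)) := [set c |
  (exists x, [/\ x \in part c, x \notin y.2.1 & clopen x (acc y.1)]) \/
  (exists q, [/\ y.1 q, q <> acc y.1, agree y.2.2 (acc y.1) q,
     q \in forbidden c
   & forall x, x \in part c -> clopen x q -> x \in y.2.1])].
pose Dhit (y : set atom * (nat * seq (seq bool) * seq atom)) := [set c |
  exists x t, [/\ x \in part c, y.1 x /\ x \notin y.2.2, prefix t (stem c),
    y.2.1.1 <= size t & fits y.2.1.1 (Qf y.1) (t :: y.2.1.2) x]].
pose RRi := [set R | RR R /\ infinite_set R].
pose XXp := [set X | XX X /\ positive (Qf X) X].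
have cRRi : countable RRi by apply: countable_subset cRR => R [].
have cXXp : countable XXp by apply: countable_subset cXX => X [].
pose DD := (Dstem @` setT `|` Dforb @` (P `|` acc @` RRi)) `|`
  (Ddis @` (RRi `*` setT) `|` Dhit @` (XXp `*` setT)).
have cDD : countable DD.
  apply: countableU; apply: countableU; apply: countable_image => //.
  - by apply: countableU => //; exact: countable_image.
  - by apply: countableX => //; exact: countableP.
  - by apply: countableX => //; exact: countableP.
have [|//|||c [cv cs cD]] :=
  generic_sequence valid extends DD (Approx [::] [::] [::]) => //.
- exact: extends_refl.
- move=> d [[[n _ <-]|[p _ <-]]|[[[R [w n]] [[_ Rinf] _] <-]|
    [[X [[n Vs] w]] [[_ posX] _] <-]]] s vs.
  + exact: dense_stem.
  + by have [s' [? ? _ ?]] := forbid p s vs; exists s'.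
  + exact: (dense_disjoint R (acc R) w n s (accP R Rinf) vs).
  + exact: (dense_hit _ _ _ _ _ _ posX vs).
have cle m n : m <= n -> extends (c m) (c n).
  elim: n => [|n IH]; first by rewrite leqn0 => /eqP ->; exact: extends_refl.
  rewrite leq_eqVlt => /orP[/eqP ->|/IH mn]; first exact: extends_refl.
  exact: extends_trans mn (cs n).
have cmax m n : exists k, extends (c m) (c k) /\ extends (c n) (c k).
  by exists (maxn m n); split; apply: cle; rewrite ?leq_maxl ?leq_maxr.
have [r rP] : exists r, forall n, cyl (stem (c n)) r.
  have long i : exists n, i < size (stem (c n)).
    by apply: (cD (Dstem i.+1)); left; left; exists i.+1.
  have [f fP] := choice long.
  exists (fun i => nth false (stem (c (f i))) i) => n i ni.
  have [k [[_ nk _ _] [_ ik _ _]]] := cmax n (f i).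
  have hn := cyl_prefix nk (cyl_nth _) i ni.
  by rewrite hn (cyl_prefix ik (cyl_nth _) i (fP i)).
pose a := [set x | exists n, x \in part (c n)].
(* From stage m on no new element may contain the forbidden [p], so only the finite part of that
   stage matters. *)
have late m p x : p \in forbidden (c m) -> a x -> clopen x p -> x \in part (c m).
  move=> mp [n nx] xp; have [k [[_ _ _ mk] [nk _ _ _]]] := cmax m n.
  by apply: contrapT => /negP mx; exact: (mk x (nk x nx) mx p).
have forbE p : P p \/ (exists2 R, RRi R & acc R = p) ->
    exists n, p \in forbidden (c n).
  move=> pP; apply: (cD (Dforb p)); left; right; by exists p.
exists r, a; split.
- move=> Pr; have [n nr] := forbE r (or_introl Pr).
  by have [/(_ r nr)] := cv n.
- by move=> x [n nx]; have [_] := cv n; apply; [exact: nx|].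
- move=> p Pp; have [n np] := forbE p (or_introl Pp).
  by apply: sub_finite_set (finite_seq (part (c n))) => x [/= ax /(late n)]; apply.
- move=> R RRR Rinf.
  have RRiR : RRi R by split.
  have [m mp] : exists n, acc R \in forbidden (c n).
    by apply: forbE; right; exists R.
  (* As [acc R] is already forbidden at stage m, [late] rules out the first alternative of [Ddis]
     for this choice of w. *)
  exists (part (c m)); apply: (@acc_infinite _ (acc R)) => n.
  have [k []] : exists k, Ddis (R, (part (c m), n)) (c k).
    by apply: cD; right; left; exists (R, (part (c m), n)).
    move=> /= [x [kx /negP mx xR]]; case: mx; apply: late xR => //.
    by exists k.
  move=> /= [q [Rq qR agq kq disj]]; exists q => //; split=> // x ax xq.
  by apply: disj => //; exact: late xq.
- move=> X XXX posX n Vs w.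
  have [k [x [t /= [kx [Xx xw] tk nt fx]]]] :
      exists k, Dhit (X, (n, Vs, w)) (c k).
    by apply: cD; right; right; exists (X, (n, Vs, w)).
  have tr := cyl_prefix tk (rP k).
  have ar : a x by exists k.
  have xr : clopen x r by have [_] := cv k; apply; [exact: kx|].
  exists x; split=> //; case: fx => meet sub avoid; split=> //.
    move=> V; rewrite inE => /orP[/eqP ->|VVs].
      by exists r => //; apply/cyl_mkseq.
    by apply: meet; rewrite inE VVs orbT.
  move=> p /sub[|[V]]; first by left.
  rewrite inE => /orP[/eqP -> tp|VVs Vp]; right; last first.
    by exists V; rewrite // inE VVs orbT.
  (* [t] is an initial segment of r of length at least n, so its cylinder lies inside that of
     [mkseq r n]. *)
  exists (mkseq r n); rewrite ?mem_head//; apply/cyl_mkseq => i ni.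
  by rewrite -tr ?tp//; exact: leq_trans nt.
Qed.

(** For [r b] close to [p], the neighbourhood of [r b] that [positive_at] lets K_x use lies near
    [p], which positivity over [p :: Q] permits. Shrinking this neighbourhood and the cylinders
    keeps K_x off [p] itself. *)
Lemma positive_union {I : Type} (s : set I) (r : I -> point)
    (a : I -> set atom) (p : point) Q X :
  (forall n, exists2 q, (r @` s) q & q <> p /\ agree n p q) ->
  (forall b, s b -> positive_at (r b) Q (a b `&` X)) ->
  positive (p :: Q) ([set x | exists2 b, s b & a b x] `&` X).
Proof.
move=> acc pos n Vs w _.
have [Us [sUs VU UD]] := cyls_avoid Vs (p :: Q).
(* [m] keeps [r b] out of [Q], [m'] keeps [p] away from the reals of [Q] other than itself, and [k]
   below keeps the neighbourhood of [r b] off [p :: Q]. *)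
have [m mP] := separate p Q.
have [m' m'P] := separate_seqs Q [:: p].
have [q [b sb <-] [rp prb]] := acc (maxn n m).
have nrb : r b \notin p :: Q.
  rewrite inE; apply/norP; split; first exact/eqP.
  apply/negP => rQ; apply: rp; apply: mP rQ _.
  by apply: agree_le prb; exact: leq_maxr.
have [k kP] := separate (r b) (p :: Q).
have [x [[abx Xx] xw xr [meet sub avoid]]] :=
  pos b sb (maxn (maxn n m') k) Us w.
have pn d : agree (maxn (maxn n m') k) (r b) d -> d \notin p :: Q.
  move=> rd; apply/negP => dQ; move: nrb; rewrite -(kP d dQ) ?dQ//.
  by apply: agree_le rd; exact: leq_maxr.
have xp : ~ clopen x p.
  move=> xp; case: (sub p xp) => [[d dQ dp]|[V + Vp]].
    apply: (avoid d dQ); rewrite -(m'P d p)// ?mem_head//.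
    by apply: agree_le dp; rewrite -maxnA maxnCA leq_maxl.
  rewrite inE => /orP[/eqP VE|/UD /(_ (mem_head _ _))/(_ Vp)//].
  by move: Vp; rewrite VE => /cyl_mkseq /pn; rewrite mem_head.
exists x; split=> //; first by split=> //; exists b.
split=> [V VVs|d xd|d].
- have iV : index V Vs < size Vs by rewrite index_mem.
  have [|d xd Ud] := meet (nth [::] Us (index V Vs)).
    by rewrite inE mem_nth ?orbT// sUs.
  by exists d => //; apply: cyl_prefix Ud; rewrite -{1}(nth_index [::] VVs) VU.
- case: (sub d xd) => [[e eQ ed]|[V + Vd]].
    left; exists e; first by rewrite inE eQ orbT.
    by apply: agree_le ed; rewrite -maxnA leq_maxl.
  rewrite inE => /orP[/eqP VE|UUs].
    left; exists p; first exact: mem_head.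
    apply: (agree_trans (agree_le (leq_maxl _ _) prb)).
    move: Vd; rewrite VE => /cyl_mkseq; apply: agree_le.
    by rewrite -maxnA leq_maxl.
  right; have iU : index V Us < size Vs by rewrite -sUs index_mem.
  exists (nth [::] Vs (index V Us)); first exact: mem_nth.
  by apply: cyl_prefix Vd; rewrite -{2}(nth_index [::] UUs) VU.
- by rewrite inE => /orP[/eqP ->|/avoid].
Qed.

(** * The recursion and the theorem *)

Fixpoint meet_of_unions {O : Type} (s : O -> set O) (a : O -> set atom)
    (t : seq O) : set atom :=
  if t is xi :: t' then
    [set x | exists2 b, s xi b & a b x] `&` meet_of_unions s a t'
  else setT.

Lemma eq_meet_of_unions {O : Type} (s s' : O -> set O) (a a' : O -> set atom)
    (t : seq O) :
  (forall xi, List.In xi t -> s xi = s' xi) ->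
  (forall xi b, List.In xi t -> s xi b -> a b = a' b) ->
  meet_of_unions s a t = meet_of_unions s' a' t.
Proof.
elim: t => //= xi t IH ss aa; rewrite IH.
- congr setI; apply/seteqP; split=> x [b sb abx]; exists b.
  + by rewrite -(ss xi)//; left.
  + by rewrite -(aa xi)//; left.
  + by rewrite (ss xi)//; left.
  + by rewrite (aa xi)//; [left|rewrite (ss xi)//; left].
- by move=> eta eta_t; apply: ss; right.
- by move=> eta b eta_t; apply: aa; right.
Qed.

Lemma meet_of_unionsP {O : Type} (s : O -> set O) (a : O -> set atom)
    (t : seq O) (x : atom) (xi : O) :
  meet_of_unions s a t x -> List.In xi t -> exists2 b, s xi b & a b x.
Proof. by elim: t => //= eta t IH [xeta xt] [<-//|]; exact: IH. Qed.

(** Otherwise countably many countable initial segments would cover [O]. *)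
Lemma countable_bounded {O : Type} (lt : O -> O -> Prop) (Z : set O) :
  is_omega1 lt -> countable Z -> exists d, forall z, Z z -> lt z d.
Proof.
move=> [_ [_ [tri [_ [unc init]]]]] cZ; apply: contrapT => nd; apply: unc.
pose below := \bigcup_(z in Z) ([set z] `|` [set b | lt b z]).
apply: (@countable_subset _ _ below) => [d _|]; last first.
  apply: bigcup_countable => // z _; exact: countableU.
apply: contrapT => nbd; apply: nd; exists d => z Zz.
have [//|[zd|dz]] := tri z d; case: nbd; exists z => //; first by left.
by right.
Qed.

Lemma stick_enumeration (O : Type) : stick_principle O ->
  exists s : O -> set O,
    (forall xi, countable (s xi) /\ infinite_set (s xi)) /\
    (forall X, ~ countable X -> exists xi, s xi `<=` X).
Proof.
move=> [S [/card_esym/card_set_bijP[s [sS _ sonto]] Scount Sstick]].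
exists s; split=> [xi|X /Sstick[z Sz zX]]; first by apply: Scount; exact: sS.
by have [xi _ szE] := sonto z Sz; exists xi; rewrite szE.
Qed.

(* The sets [s xi] are cut at [al] so that stage [al] refers to earlier stages
   only; for large [al] the cut changes nothing. *)
Lemma approximating_family (O : Type) (lt : O -> O -> Prop) (s : O -> set O)
    (Qf : set atom -> seq point) :
  is_omega1 lt ->
  exists (r : O -> point) (a : O -> set atom), forall al,
    [/\ forall b, lt b al -> r b <> r al,
        forall x, a al x -> clopen x (r al),
        forall b, lt b al -> finite_set [set x | a al x /\ clopen x (r b)],
        forall xi, lt xi al -> infinite_set (r @` (s xi `&` lt^~ al)) ->
          exists w : seq atom,
          infinite_set [set q | (r @` (s xi `&` lt^~ al)) q /\
             forall x, a al x -> clopen x q -> x \in w]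
      & forall t, (forall xi, List.In xi t -> lt xi al) ->
          let X := meet_of_unions (fun xi => s xi `&` lt^~ al) a t in
          positive (Qf X) X -> positive_at (r al) (Qf X) (a al `&` X)].
Proof.
move=> [_ [_ [_ [wf [_ init]]]]].
pose Phi al (f : O -> point * set atom) (y : point * set atom) :=
  let sal xi := s xi `&` lt^~ al in
  [/\ forall b, lt b al -> (f b).1 <> y.1,
      forall x, y.2 x -> clopen x y.1,
      forall b, lt b al -> finite_set [set x | y.2 x /\ clopen x (f b).1],
      forall xi, lt xi al -> infinite_set ((fun b => (f b).1) @` sal xi) ->
        exists w : seq atom,
        infinite_set [set q | ((fun b => (f b).1) @` sal xi) q /\
           forall x, y.2 x -> clopen x q -> x \in w]
    & forall t, (forall xi, List.In xi t -> lt xi al) ->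
        let X := meet_of_unions sal (fun b => (f b).2) t in
        positive (Qf X) X -> positive_at y.1 (Qf X) (y.2 `&` X)].
have [|||F FP] := wf_recursive_choice lt Phi wf.
- move=> al f g fg y [h1 h2 h3 h4 h5]; split=> //.
  + by move=> b bal; rewrite -fg//; exact: h1.
  + by move=> b bal; rewrite -fg//; exact: h3.
  + move=> xi xial.
    suff <- : (fun b => (f b).1) @` (s xi `&` lt^~ al) =
              (fun b => (g b).1) @` (s xi `&` lt^~ al) by exact: h4.
    by apply/seteqP; split=> _ [b [sb bal] <-]; exists b; rewrite ?fg.
  + move=> t tal; rewrite -(@eq_meet_of_unions _ (fun xi => s xi `&` lt^~ al)
      (fun xi => s xi `&` lt^~ al) (fun b => (f b).2)).
    * exact: h5.
    * by [].
    * by move=> xi b _ [_ /fg ->].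
- move=> al f; pose sal xi := s xi `&` lt^~ al.
  (* Only countably many demands arise: one for each earlier real, each earlier stick set and each
     finite list of earlier indices. *)
  have [|||r [a [h1 h2 h3 h4 h5]]] := generic_stage
    ((fun b => (f b).1) @` (lt^~ al))
    ((fun xi => (fun b => (f b).1) @` sal xi) @` (lt^~ al))
    (meet_of_unions sal (fun b => (f b).2) @`
       [set t | forall xi, List.In xi t -> lt xi al]) Qf.
  + by apply: countable_image; exact: init.
  + by apply: countable_image; exact: init.
  + by apply: countable_image; apply: countable_lists; exact: init.
  exists (r, a); split=> //=.
  + by move=> b bal fb; apply: h1; exists b.
  + by move=> b bal; apply: h3; exists b.
  + by move=> xi xial; apply: h4; exists xi.
  + by move=> t tal; apply: h5; exists t.
- exact: inhabits (fun=> false, set0).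
by exists (fun b => (F b).1), (fun b => (F b).2) => al; exact: FP.
Qed.

Lemma positive_infinite Q X : positive Q X -> infinite_set X.
Proof.
move=> posX /finite_seqP[w XE]; have [//|x [Xx]] := posX 0 [:: [::]] w.
by move: Xx; rewrite XE /= => ->.
Qed.

Lemma positive_at_infinite r Q X : positive_at r Q X -> infinite_set X.
Proof.
move=> posX /finite_seqP[w XE]; have [x [Xx]] := posX 0 [::] w.
by move: Xx; rewrite XE /= => ->.
Qed.

Theorem theorem3p2 (O : Type) (lt : O -> O -> Prop) :
  is_omega1 lt -> stick_principle O ->
  exists (W : Type) (A : set (set W)),
    countable [set: W] /\
    strongly_near_Luzin A /\
    ~ (exists2 B : set (set W), B `<=` A & ~ countable B /\ Luzin lt B).
Proof.
move=> om /stick_enumeration[s [sinf stick]].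
(* One witness of positivity is fixed in advance for each [X], so that every stage handles the same
   one; [[::]] is a dummy. *)
have exQ (X : set atom) : exists Q, (exists Q, positive Q X) -> positive Q X.
  have [[Q posX]|nX] := pselect (exists Q, positive Q X); first by exists Q.
  by exists [::].
have [Qf QfP] := choice exQ.
have [r [a ra]] := approximating_family O lt s Qf om.
have [irr [trans [tri [wf [unc init]]]]] := om.
have rinj : injective r.
  move=> b c rbc; have [bc|[//|cb]] := tri b c.
    by have [/(_ b bc)] := ra c.
  by have [/(_ c cb)/(_ (esym rbc))] := ra b.
have arE al x : a al x -> clopen x (r al) by have [_ + _ _ _] := ra al; apply.
(* The empty list of indices yields the positive set [setT]. *)
have ainf al : infinite_set (a al).
  have [_ _ _ _ posa] := ra al; have := posa [::] (fun _ F => False_ind _ F).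
  rewrite /= setIT => {}posa.
  apply: (positive_at_infinite (r al) (Qf setT)); apply: posa; apply: QfP.
  by exists [::]; exact: positive_setT.
have lt_fin b c : lt b c -> finite_set (a c `&` a b).
  move=> bc; have [_ _ /(_ b bc) fin _ _] := ra c.
  by apply: sub_finite_set fin => x [acx /arE].
have a_fin b c : b <> c -> finite_set (a b `&` a c).
  move=> bc; have [/lt_fin|[//|/lt_fin//]] := tri b c.
  by rewrite setIC.
have ainj : injective a.
  move=> b c abc; apply: contrapT => /a_fin.
  by rewrite abc setIid; exact: ainf.
have rs_inf xi : infinite_set (r @` s xi).
  move=> /(@finite_preimage _ _ _ r) fin; apply: (sinf xi).2.
  apply: (@sub_finite_set _ _ (r @^-1` (r @` s xi))) => [b|]; first by exists b.
  by apply: fin => b c _ _; exact: rinj.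
have above d (C : set O) : ~ countable C -> ~ countable (C `&` lt d).
  move=> uC cC; apply: uC; apply: (@countable_subset _ _
    ((C `&` lt d) `|` ([set b | lt b d] `|` [set d]))).
    move=> c Cc; have [cd|[->|dc]] := tri c d; [right; left|right; right|left] => //.
  by apply: countableU => //; apply: countableU => //; exact: countable1.
have inter (C : nat -> set O) k : (forall i, ~ countable (C i)) ->
    exists t, (exists Q, positive Q (meet_of_unions s a t)) /\
      forall i, i < k -> exists2 xi, List.In xi t & s xi `<=` C i.
  move=> uC; elim: k => [|k [t [posX tC]]].
    by exists [::]; split=> //; exists [::]; exact: positive_setT.
  (* Beyond a bound [d] of [Z], cutting at a stage leaves the stick sets listed in [t] unchanged.
     The next stick set is therefore taken inside the part of [C k] above [d]. *)
  pose Z := \bigcup_(xi in [set xi | List.In xi t]) ([set xi] `|` s xi).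
  have [|d dP] := countable_bounded lt Z om.
    apply: bigcup_countable => [|xi _]; last first.
      by apply: countableU; [exact: countable1|exact: (sinf xi).1].
    elim: t {posX tC Z} => [|eta t IH]; first by apply: countable_subset (countable0 O).
    apply: (@countable_subset _ _ ([set eta] `|` [set xi | List.In xi t])).
      by move=> xi [->|]; [left|right].
    by apply: countableU => //; exact: countable1.
  have [xi xiC] := stick _ (above d _ (uC k)).
  have [p pacc] := acc_point _ (rs_inf xi).
  exists (xi :: t); split; last first.
    move=> i; rewrite ltnS leq_eqVlt => /orP[/eqP ->|/tC[eta et eC]].
      by exists xi; [left|move=> b /xiC[]].
    by exists eta => //; right.
  exists (p :: Qf (meet_of_unions s a t)).
  apply: (positive_union (s xi) r a p _ _ pacc) => b sb.
  have db : lt d b by have [] := xiC b sb.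
  have tb eta : List.In eta t -> lt eta b.
    by move=> et; apply: trans db; apply: dP; exists eta => //; left.
  have [_ _ _ _ /(_ t tb)] := ra b.
  suff -> : meet_of_unions (fun xi => s xi `&` lt^~ b) a t =
            meet_of_unions s a t by apply; exact: QfP.
  apply: eq_meet_of_unions => // eta et; apply/seteqP; split=> [c []//|c sc].
  by split=> //; apply: trans db; apply: dP; exists eta => //; right.
exists atom, (range a); split; first exact: countableP.
split; first split.
- split=> [_ [b _ <-]//|_ _ [b _ <-] [c _ <-] abc].
  by apply: a_fin => bc; apply: abc; rewrite bc.
- split=> [cA|n C CP].
    apply: unc; apply: countable_subset (countable_preimage a _ ainj cA).
    by move=> b _; exists b.
  have [|t [[Q posX] tC]] := inter (fun i => a @^-1` C (inord i)) n.+1.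
    move=> i cC; have [sub uC] := CP (inord i); apply: uC.
    apply: countable_subset (countable_image a _ cC) => c Cc.
    by have [b _ bc] := sub c Cc; exists b => //=; rewrite bc.
  apply: contra_not (positive_infinite _ _ posX).
  apply: sub_finite_set => x Xx i.
  have [xi xit xiC] := tC i (ltn_ord i).
  have [b sb abx] := meet_of_unionsP _ _ _ _ _ Xx xit.
  by exists (a b) => //; have := xiC b sb; rewrite /= inord_val.
move=> [B BA [_ [_ [_ [e [einj eB luzin]]]]]].
have exg o : exists b, e o = a b.
  by have [|b _ <-] := BA (e o); [rewrite -eB; exists o|exists b].
have [g gP] := choice exg.
have ginj : injective g.
  by move=> o o' gg; apply: einj; rewrite !gP gg.
have [|xi xig] := stick (range g).
  move=> cg; apply: unc; apply: countable_subset (countable_preimage g _ ginj cg).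
  by move=> o _; exists o.
have [sc _] := sinf xi.
have [|d dP] := countable_bounded lt (xi |` s xi) om.
  by apply: countableU => //; exact: countable1.
(* The Luzin enumeration [e] may order the family differently from [a]; [o] lies past every index
   that [g] sends into [s xi] or to a stage not above [d]. *)
have [|o oP] := countable_bounded lt
    (g @^-1` ((s xi) `|` ([set b | lt b d] `|` [set d]))) om.
  apply: countable_preimage => //; apply: countableU => //.
  by apply: countableU => //; exact: countable1.
have dgo : lt d (g o).
  have [//|go] := tri d (g o).
  case: (irr o); apply: oP; by case: go => ?; right; [right|left].
have sgo : s xi `&` lt^~ (g o) = s xi.
  apply/seteqP; split=> [b []//|b sb]; split=> //.
  by apply: trans dgo; apply: dP; right.
have [_ _ _ /(_ xi) + _] := ra (g o); rewrite sgo => /(_ _ (rs_inf xi)).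
case; first by apply: trans dgo; apply: dP; left.
move=> w; apply.
(* The infinitely many reals left by the construction all come from indices in this finite set. *)
have fin := luzin [set` w] o (finite_seq w).
apply: sub_finite_set (finite_image (r \o g) fin) => q [[b sb <-] disj].
have [o' _ go'] := xig b sb; exists o'; last by rewrite /= go'.
split; first by apply: oP; left; rewrite /= go'.
by move=> x; rewrite !gP go' => -[ax bx]; apply: disj => //; exact: arE.
Qed.
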